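(* Let $M$ and $N$ be finitely presented $B_n$-persistence modules. Then $d_I(M,N)\in U_{M,N}$, where $$U_{M,N}=\bigcup_{i=1}^n\Big(\{|x-y|: x\in U_M^i,\,y\in U_N^i\}\cup\{\tfrac12|x-y|: x,y\in U_M^i\}\cup\{\tfrac12|x-y|: x,y\in U_N^i\}\Big)\cup\{0,\infty\}.$$
   Context: Fix a field $k$ and $n\ge 1$. $B_n=k[\mathbb{R}_{\ge0}^n]$ is the monoid ring of $(\mathbb{R}^n_{\ge0},+)$. A $B_n$-persistence module is a $B_n$-module $M$ with a $k$-vector space decomposition $M=\bigoplus_{a\in\mathbb{R}^n}M_a$ such that $x_i^{\alpha}(M_a)\subset M_{a+\alpha \mathbf{e}_i}$ for all $a$, $\alpha\ge0$; morphisms are module homomorphisms $f$ with $f(M_a)\subset N_a$. For $a\le b$ (product order) the transition map $\varphi_M(a,b):M_a\to M_b$ is multiplication by $x_1^{b_1-a_1}\cdots x_n^{b_n-a_n}$. For $v\in\mathbb{R}^n$, $M(v)_a=M_{a+v}$. For $\epsilon\ge0$ let $\vec\epsilon=(\epsilon,\dots,\epsilon)$, $M(\epsilon)=M(\vec\epsilon)$, $f(\epsilon)_a=f_{a+\vec\epsilon}$, and $S(M,\epsilon):M\to M(\epsilon)$ with $S(M,\epsilon)_a=\varphi_M(a,a+\vec\epsilon)$. $M,N$ are $\epsilon$-interleaved if there are morphisms $f:M\to N(\epsilon)$, $g:N\to M(\epsilon)$ with $g(\epsilon)\circ f=S(M,2\epsilon)$ and $f(\epsilon)\circ g=S(N,2\epsilon)$.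 $d_I(M,N)=\inf\{\epsilon\ge0: M,N\text{ are }\epsilon\text{-interleaved}\}\in[0,\infty]$. An $n$-graded set is a set $G$ with a grade function $gr:G\to\mathbb{R}^n$; $\langle G\rangle=\bigoplus_{y\in G}B_n(-gr(y))$ is the free module with basis $G$. A presentation $\langle G|R\rangle$ of $M$ consists of an $n$-graded set $G$ and a set $R$ of homogeneous elements of $\langle G\rangle$ with $M\cong\langle G\rangle/\langle R\rangle$; $M$ is finitely presented if $G,R$ can be chosen finite. The presentation is minimal if the quotient map $\langle G\rangle\to\langle G\rangle/\langle R\rangle$ sends $G$ to a minimal set of generators of the quotient and $R$ is a minimal set of generators of $\langle R\rangle$. For $M$ finitely presented, $U_M\subset\mathbb{R}^n$ is the set of grades of the generators and relations in a minimal presentation of $M$ (it does not depend on the choice of minimal presentation), and $U_M^i\subset\mathbb{R}$ is the set of $i$-th coordinates of elements of $U_M$. *)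

(* Defs.v *)
From HB Require Import structures.
From mathcomp Require Import all_boot all_order all_algebra.
From mathcomp Require Import boolp classical_sets cardinality reals.
From mathcomp Require Import constructive_ereal ereal.
(* The notations of monalg clash with those of classical_sets. *)
From mathcomp Require Import -(notations) finmap.
From mathcomp.multinomials Require Import -(notations) monalg.

Set Implicit Arguments.
Unset Strict Implicit.
Unset Printing Implicit Defensive.

Import Order.TTheory GRing.Theory Num.Theory.

Local Open Scope classical_set_scope.
Local Open Scope ring_scope.

Section Monoid.
Variables (R : realType) (n : nat).

(* The monoid (R_{>=0}^n, +); monalg writes its law multiplicatively. *)
Record nnvec := NNVec {
  nnval :> 'rV[R]_n;
  nnvalP : [forall i, 0 <= nnval 0 i] }.

HB.instance Definition _ := [isSub for nnval].
HB.instance Definition _ := [Choice of nnvec by <:].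

Lemma nnvec_ge0 (v : nnvec) i : 0 <= v 0 i.
Proof. by have /forallP := nnvalP v. Qed.

Fact nnvec0_subproof : [forall i, 0 <= (0 : 'rV[R]_n) 0 i].
Proof. by apply/forallP => i; rewrite mxE. Qed.
Definition nnvec0 := NNVec nnvec0_subproof.

Fact nnvecD_subproof (v w : nnvec) : [forall i, 0 <= (nnval v + nnval w) 0 i].
Proof. by apply/forallP => i; rewrite mxE addr_ge0 ?nnvec_ge0. Qed.
Definition nnvecD v w := NNVec (nnvecD_subproof v w).

Fact nnvecDA : associative nnvecD.
Proof. by move=> u v w; apply/val_inj/addrA. Qed.
Fact nnvec0D : left_id nnvec0 nnvecD.
Proof. by move=> u; apply/val_inj/add0r. Qed.
Fact nnvecD0 : right_id nnvec0 nnvecD.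
Proof. by move=> u; apply/val_inj/addr0. Qed.
Fact nnvecDC : commutative nnvecD.
Proof. by move=> u v; apply/val_inj/addrC. Qed.
Fact nnvecD_eq0 v w : nnvecD v w = nnvec0 -> v = nnvec0 /\ w = nnvec0.
Proof.
move=> /(congr1 nnval)/rowP vw0.
have h i : v 0 i == 0 /\ w 0 i == 0.
  apply/andP; rewrite -paddr_eq0 ?nnvec_ge0 //.
  by have := vw0 i; rewrite !mxE => ->.
by split; apply/val_inj/rowP => i; have [/eqP v0 /eqP w0] := h i; rewrite mxE.
Qed.

HB.instance Definition _ :=
  Choice_isMonomialDef.Build nnvec nnvecDA nnvec0D nnvecD0 nnvecD_eq0.
HB.instance Definition _ := MonomialDef_isConomialDef.Build nnvec nnvecDC.

Fact nnvec_axis_subproof (i : 'I_n) (al : R) (al0 : 0 <= al) :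
  [forall j, 0 <= (al *: delta_mx 0 i : 'rV[R]_n) 0 j].
Proof. by apply/forallP => j; rewrite !mxE mulr_ge0. Qed.
Definition nnvec_axis i al al0 := NNVec (@nnvec_axis_subproof i al al0).

Fact nnvec_diag_subproof (e : R) (e0 : 0 <= e) :
  [forall j, 0 <= (const_mx e : 'rV[R]_n) 0 j].
Proof. by apply/forallP => j; rewrite mxE. Qed.
Definition nnvec_diag e e0 := NNVec (@nnvec_diag_subproof e e0).

End Monoid.

Section PersistenceModules.
Variables (k : fieldType) (R : realType) (n : nat).

(* The monoid ring k[R_{>=0}^n]; malg takes the monoid first. *)
Definition Bn : comNzRingType := malg (nnvec R n) k.

(* [xpow v] is the monomial x_1^{v_1} ... x_n^{v_n}. *)
Definition xpow (v : nnvec R n) : Bn := mkmalgU v 1.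
Definition Bscalar (c : k) : Bn := mkmalgU (nnvec0 R n) c.

(* [M_] is a decomposition M = \bigoplus_a M_a as a k-vector space, compatible
   with the action of the x_i^al; the last two fields are existence and
   uniqueness of the decomposition of an element into homogeneous components. *)
Record is_grading (M : lmodType Bn) (M_ : 'rV[R]_n -> set M) : Prop := {
  grading0 : forall a, M_ a 0;
  gradingD : forall a m m', M_ a m -> M_ a m' -> M_ a (m + m');
  gradingZ : forall a c m, M_ a m -> M_ a (Bscalar c *: m);
  gradingX : forall (i : 'I_n) (al : R) (al0 : 0 <= al) a m,
    M_ a m -> M_ (a + al *: delta_mx 0 i) (xpow (nnvec_axis i al0) *: m);
  grading_span : forall m, exists (s : seq 'rV[R]_n) (f : 'rV[R]_n -> M),
    [/\ uniq s, forall a, M_ a (f a) & m = \sum_(a <- s) f a];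
  grading_direct : forall (s : seq 'rV[R]_n) (f : 'rV[R]_n -> M),
    uniq s -> (forall a, M_ a (f a)) -> \sum_(a <- s) f a = 0 ->
    forall a, a \in s -> f a = 0 }.

Record pmod := PMod {
  pm_sort :> lmodType Bn;
  pm_comp : 'rV[R]_n -> set pm_sort;
  pm_grading : is_grading pm_comp }.
Arguments pm_comp : clear implicits.

Record hom (M N : pmod) := Hom {
  hom_fun :> {linear M -> N};
  homP : forall a m, pm_comp M a m -> pm_comp N a (hom_fun m) }.

Definition isomorphic (M N : pmod) : Prop :=
  exists (f : hom M N) (g : hom N M), cancel f g /\ cancel g f.

Fact shift_subproof (M : pmod) (v : 'rV[R]_n) :
  is_grading (fun a => pm_comp M (a + v)).
Proof.
have [M0 MD MZ MX Msp Mdir] := pm_grading M; split.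
- by move=> a; apply: M0.
- by move=> a m m'; apply: MD.
- by move=> a c m; apply: MZ.
- by move=> i al al0 a m Mm; rewrite addrAC; apply: MX.
- move=> m; have [s [f [us Mf ->]]] := Msp m.
  exists [seq a - v | a <- s], (fun a => f (a + v)); split.
  + by rewrite map_inj_uniq //; apply: addIr.
  + by move=> a; apply: Mf.
  + by rewrite big_map; apply: eq_bigr => a _; rewrite subrK.
- move=> s f us Mf f0 a sa.
  have := Mdir [seq a + v | a <- s] (fun a => f (a - v)).
  move=> /(_ _ _ _ (a + v)); rewrite addrK; apply.
  + by rewrite map_inj_uniq //; apply: addIr.
  + by move=> b; have := Mf (b - v); rewrite subrK.
  + by rewrite big_map -[RHS]f0; apply: eq_bigr => b _; rewrite addrK.
  + exact: (map_f (fun b => b + v)).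
Qed.

(* The shift M(v): the same B_n-module, with M(v)_a = M_{a + v}. *)
Definition shift (M : pmod) (v : 'rV[R]_n) : pmod :=
  PMod (shift_subproof M v).

Definition eshift (M : pmod) (e : R) : pmod := shift M (const_mx e).

(* f(e) has the same underlying map as f: only the gradings are shifted. *)
Fact eshift_hom_subproof M N (f : hom M N) (e : R) a m :
  pm_comp (eshift M e) a m -> pm_comp (eshift N e) a (f m).
Proof. exact: (homP f). Qed.
Definition eshift_hom M N (f : hom M N) (e : R) :
    hom (eshift M e) (eshift N e) :=
  @Hom (eshift M e) (eshift N e) (hom_fun f) (@eshift_hom_subproof M N f e).

Lemma xpowD v w : xpow (nnvecD v w) = xpow v * xpow w.
Proof.
by rewrite /xpow malgM_def fgmulUU mulr1.
Qed.

Lemma xpow0 : xpow (nnvec0 R n) = 1.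
Proof. by []. Qed.

(* The transition maps are compositions of the actions of the x_i^al. *)
Lemma pm_comp_xpow (M : pmod) (v : nnvec R n) a m :
  pm_comp M a m -> pm_comp M (a + nnval v) (xpow v *: m).
Proof.
move=> Mm; have gX := gradingX (pm_grading M).
pose w (s : seq 'I_n) : nnvec R n :=
  foldr (fun i u => nnvecD (nnvec_axis i (nnvec_ge0 v i)) u) (nnvec0 R n) s.
have wE s : pm_comp M (a + nnval (w s)) (xpow (w s) *: m).
  elim: s => [|i s IHs] /=; first by rewrite xpow0 scale1r addr0.
  by rewrite xpowD -scalerA [X in a + X]addrC addrA; apply: gX.
suff -> : v = w (enum 'I_n) by apply: wE.
apply/val_inj => /=; have -> s : nnval (w s) = \sum_(i <- s) v 0 i *: delta_mx 0 i.
  by elim: s => [|i s IHs] /=; rewrite ?big_nil // big_cons IHs.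
by rewrite big_enum /=; apply: row_sum_delta.
Qed.

Section Smap.
Variables (M : pmod) (e : R) (e0 : 0 <= e).

Definition Sfun (m : M) : eshift M e := xpow (nnvec_diag n e0) *: m.

Fact Sfun_linear : linear Sfun.
Proof.
by move=> b x y; rewrite /Sfun scalerDr !scalerA mulrC.
Qed.
HB.instance Definition _ := GRing.isLinear.Build Bn M (eshift M e) _ Sfun Sfun_linear.

Fact Sfun_hom a m : pm_comp M a m -> pm_comp (eshift M e) a (Sfun m).
Proof. exact: (@pm_comp_xpow M (nnvec_diag n e0)). Qed.

(* S(M, e) : M -> M(e) is the transition map M_a -> M_{a + (e, ..., e)} in each
   degree a, that is, multiplication by x_1^e ... x_n^e. *)
Definition Smap : hom M (eshift M e) := @Hom M (eshift M e) Sfun Sfun_hom.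

End Smap.

(* M(e)(e) and M(2e) have the same underlying module M, in which the two sides
   are compared. *)
Definition interleaved (M N : pmod) (e : R) (e0 : 0 <= e) : Prop :=
  exists (f : hom M (eshift N e)) (g : hom N (eshift M e)),
    (forall m, eshift_hom g e (f m) = Smap M (mulrn_wge0 2 e0) m :> M) /\
    (forall m, eshift_hom f e (g m) = Smap N (mulrn_wge0 2 e0) m :> N).

Definition dI (M N : pmod) : \bar R :=
  ereal_inf [set e%:E | e in [set e | exists e0 : 0 <= e, interleaved M N e0]].

Section Span.
Variable M : lmodType Bn.

Definition span (S : set M) : set M :=
  [set m | exists s : seq (Bn * M),
     (forall p, p \in s -> S p.2) /\ m = \sum_(p <- s) p.1 *: p.2].

Definition minimal_generators (S W : set M) : Prop :=
  span S = W /\ forall T, T `<` S -> span T <> W.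

Lemma span0 S : span S 0.
Proof. by exists [::]; rewrite big_nil. Qed.
Lemma spanD S x y : span S x -> span S y -> span S (x + y).
Proof.
move=> [s [Ss ->]] [t [St ->]]; exists (s ++ t); rewrite big_cat; split=> // p.
by rewrite mem_cat => /orP[/Ss|/St].
Qed.
Lemma spanZ S b x : span S x -> span S (b *: x).
Proof.
move=> [s [Ss ->]]; exists [seq (b * p.1, p.2) | p <- s]; split.
  by move=> _ /mapP[p /Ss Sp ->].
by rewrite big_map scaler_sumr; apply: eq_bigr => p _; rewrite scalerA.
Qed.
Lemma spanS S x : S x -> span S x.
Proof.
move=> Sx; exists [:: (1, x)]; rewrite big_seq1 scale1r; split=> // p.
by rewrite inE => /eqP->.
Qed.
Lemma span_sum S I (s : seq I) (P : pred I) F :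
  (forall i, P i -> span S (F i)) -> span S (\sum_(i <- s | P i) F i).
Proof. by move=> SF; apply: big_ind => //; [apply: span0|apply: spanD]. Qed.

Definition spanb (S : set M) (m : M) : bool := `[< span S m >].

Fact spanb_zmod S : zmod_closed (spanb S).
Proof.
split=> [|x y]; rewrite !unfold_in; first by apply/asboolP/span0.
move=> /asboolP Sx /asboolP Sy; apply/asboolP/spanD => //.
by rewrite -scaleN1r; apply: spanZ.
Qed.
HB.instance Definition _ S := GRing.isZmodClosed.Build M (spanb S) (spanb_zmod S).

Definition spanz (S : set M) : zmodClosed M :=
  GRing.ZmodClosed.clone M (spanb S) _.

Section LQuotient.
Variable S : set M.

Definition lquot := Quotient.quot (spanz S).
HB.instance Definition _ := GRing.Zmodule.on lquot.

Definition lpi (m : M) : lquot := (\pi_(Quotient.quot (spanz S)) m)%qT.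
Definition lrepr (q : lquot) : M := repr (q : Quotient.quot (spanz S)).

Lemma lreprK q : lpi (lrepr q) = q. Proof. exact: reprK. Qed.

Lemma lpi_eq x y : (lpi x = lpi y) <-> span S (x - y).
Proof.
have -> : (lpi x = lpi y) <-> spanb S (x - y).
  rewrite (rwP eqP) /lpi -Quotient.idealrBE; split=> //.
by split=> [/asboolP|?]; last apply/asboolP.
Qed.

Lemma lpiD x y : lpi (x + y) = lpi x + lpi y.
Proof. exact: (raddfD (\pi_(Quotient.quot (spanz S)))%qT). Qed.

Definition lquot_scale (b : Bn) (q : lquot) : lquot := lpi (b *: lrepr q).

Lemma lpi_scale b x : lquot_scale b (lpi x) = lpi (b *: x).
Proof.
apply/lpi_eq; rewrite -scalerBr; apply: spanZ.
by apply/lpi_eq; rewrite lreprK.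
Qed.

Fact lquot_scaleA a b q :
  lquot_scale a (lquot_scale b q) = lquot_scale (a * b) q.
Proof. by rewrite -(lreprK q) !lpi_scale scalerA. Qed.
Fact lquot_scale1 : left_id 1 lquot_scale.
Proof. by move=> q; rewrite -(lreprK q) !lpi_scale scale1r. Qed.
Fact lquot_scaleDr : right_distributive lquot_scale +%R.
Proof.
by move=> b x y; rewrite -(lreprK x) -(lreprK y) -lpiD !lpi_scale scalerDr lpiD.
Qed.
Fact lquot_scaleDl q : {morph lquot_scale^~ q : a b / a + b}.
Proof. by move=> a b; rewrite -(lreprK q) !lpi_scale scalerDl lpiD. Qed.
HB.instance Definition _ := GRing.Zmodule_isLmodule.Build Bn lquot
  lquot_scaleA lquot_scale1 lquot_scaleDr lquot_scaleDl.

Fact lpi_linear : linear lpi.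
Proof. by move=> b x y; rewrite lpiD -lpi_scale. Qed.
HB.instance Definition _ := GRing.isLinear.Build Bn M lquot _ lpi lpi_linear.

End LQuotient.
End Span.

(* A finite sum of homogeneous elements can be regrouped by degree. *)
Lemma collect (M : lmodType Bn) (M_ : 'rV[R]_n -> set M)
    (t : seq ('rV[R]_n * M)) :
  (forall a, M_ a 0) ->
  (forall a m m', M_ a m -> M_ a m' -> M_ a (m + m')) ->
  (forall p, p \in t -> M_ p.1 p.2) ->
  exists (s : seq 'rV[R]_n) (f : 'rV[R]_n -> M),
    [/\ uniq s, forall a, M_ a (f a) & \sum_(p <- t) p.2 = \sum_(a <- s) f a].
Proof.
move=> M0 MD Mt; exists (undup (unzip1 t)).
exists (fun a => \sum_(p <- t | p.1 == a) p.2); split; first exact: undup_uniq.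
  move=> a; rewrite big_seq_cond; apply: big_ind => //; first exact: MD.
  by move=> p /andP[pt /eqP <-]; apply: Mt.
rewrite (exchange_big_dep xpredT) //= big_seq [RHS]big_seq.
apply: eq_bigr => p pt; rewrite -big_filter (@perm_big _ _ _ _ _ [:: p.1]).
  by rewrite big_seq1.
apply: uniq_perm => //; first by rewrite filter_uniq // undup_uniq.
move=> a; rewrite mem_filter mem_undup inE [a == _]eq_sym.
by have [<-|] := eqVneq p.1 a; rewrite // map_f.
Qed.

Section QuotientModule.
Variables (F : pmod) (S : set F).
Hypothesis S_hom : forall r, S r -> exists a, pm_comp F a r.

Definition quot_comp (a : 'rV[R]_n) : set (lquot S) :=
  [set lpi S m | m in pm_comp F a].

Lemma Bn_mono (b : Bn) :
  b = \sum_(v <- msupp b) Bscalar (mcoeff v b) * xpow v.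
Proof.
rewrite {1}[b]monalgE; apply: eq_bigr => v _.
by rewrite malgM_def fgmulUU mulr1 mul1m.
Qed.

Lemma span_decomposition w : span S w ->
  exists (s : seq 'rV[R]_n) (g : 'rV[R]_n -> F),
    [/\ uniq s, forall a, pm_comp F a (g a) /\ span S (g a) &
        w = \sum_(a <- s) g a].
Proof.
have gF := pm_grading F; move=> [t [St ->]].
pose d r := xget 0 [set a | pm_comp F a r].
have dP r : S r -> pm_comp F (d r) r.
  by move=> /S_hom Sr; apply: (xgetPex _ Sr).
have [|||s [g [us Fg sg]]] := @collect F (fun a m => pm_comp F a m /\ span S m)
  [seq (d p.2 + nnval v, (Bscalar (mcoeff v p.1) * xpow v) *: p.2)
     | p <- t, v <- msupp p.1].
- by move=> a; split; [apply: grading0|apply: span0].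
- by move=> a m m' [? ?] [? ?]; split; [apply: gradingD|apply: spanD].
- move=> _ /allpairsPdep[p [v [/St Sp _ ->]]] /=; split.
    by rewrite -scalerA; apply: gradingZ => //; apply/pm_comp_xpow/dP.
  exact/spanZ/spanS.
exists s, g; split=> //; rewrite -sg big_allpairs_dep /=.
apply: eq_bigr => p _; rewrite [in LHS](Bn_mono p.1) scaler_suml.
exact: eq_bigr.
Qed.

Fact quot_subproof : is_grading quot_comp.
Proof.
have gF := pm_grading F; split.
- by move=> a; exists 0; [apply: grading0|rewrite linear0].
- move=> a _ _ [x Fx <-] [y Fy <-]; exists (x + y); last by rewrite linearD.
  exact: gradingD.
- move=> a c _ [x Fx <-]; exists (Bscalar c *: x); last by rewrite linearZ.
  exact: gradingZ.
- move=> i al al0 a _ [x Fx <-]; exists (xpow (nnvec_axis i al0) *: x).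
    exact: gradingX.
  by rewrite linearZ.
- move=> q; have [s [f [us Ff sf]]] := grading_span gF (lrepr q).
  exists s, (fun a => lpi S (f a)); split=> //; first by move=> a; exists (f a).
  by rewrite -[LHS]lreprK sf linear_sum.
- move=> s f us Ff f0 a sa.
  have /boolp.choice[f' f'P] b : exists m, pm_comp F b m /\ lpi S m = f b.
    by have [m Fm mE] := Ff b; exists m.
  have Sf' : span S (\sum_(b <- s) f' b).
    rewrite -[X in span _ X]subr0; apply/lpi_eq; rewrite linear0 linear_sum -[RHS]f0.
    by apply: eq_bigr => b _; have [] := f'P b.
  have [t [g [ut Fg sg]]] := span_decomposition Sf'.
  pose u := undup (s ++ t).
  have ext (r : seq 'rV[R]_n) (h : 'rV[R]_n -> F) : uniq r -> {subset r <= u} ->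
      \sum_(b <- r) h b = \sum_(b <- u) (if b \in r then h b else 0).
    move=> ur ru; rewrite -big_mkcond -big_filter; apply: perm_big.
    apply: uniq_perm => //; first by rewrite filter_uniq // undup_uniq.
    by move=> b; rewrite mem_filter; case: (boolP (b \in r)) => [/ru ->|].
  have := grading_direct gF (undup_uniq (s ++ t))
    (f := fun b => (if b \in s then f' b else 0) - (if b \in t then g b else 0)).
  move=> /(_ _ _ a); rewrite mem_undup mem_cat sa orTb => fg.
  have {fg} : f' a - (if a \in t then g a else 0) = 0.
    apply: fg => //.
      move=> b; rewrite -scaleN1r; apply: gradingD => //.
        by case: ifP => _; [have [] := f'P b|apply: grading0].
      have -> : -1 = Bscalar (-1) by rewrite /Bscalar monalgUN.
      by apply: gradingZ => //; case: ifP => _; [have [] := Fg b|apply: grading0].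
    rewrite sumrB -!ext ?sg ?subrr // => b; rewrite mem_undup mem_cat => ->//.
    by rewrite orbT.
  move=> /subr0_eq f'a; have [_ <-] := f'P a.
  rewrite -(linear0 (lpi S)); apply/lpi_eq; rewrite subr0 f'a.
  by case: ifP => _; [have [] := Fg a|apply: span0].
Qed.

Definition quot_pmod : pmod := PMod quot_subproof.

End QuotientModule.

Record gset := GSet { gs_sort :> choiceType; gs_gr : gs_sort -> 'rV[R]_n }.

(* (B_n)_b is spanned over k by x^b if b >= 0, and is zero otherwise. *)
Definition Bn_comp (b : 'rV[R]_n) : set Bn :=
  [set p | forall v : nnvec R n, mcoeff v p != 0 -> nnval v = b].

Section FreeModule.
Variable G : gset.

(* <G> = \bigoplus_{y in G} B_n(- gr y): finitely supported functions G -> B_n,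
   where the summand of y is shifted by - gr y. *)
Definition free_comp (a : 'rV[R]_n) : set (malg G Bn) :=
  [set p | forall y, Bn_comp (a - gs_gr y) (mcoeff y p)].

Fact free_subproof : is_grading free_comp.
Proof.
have F0 a : free_comp a 0 by move=> y v; rewrite !mcoeff0 eqxx.
have FD a p q : free_comp a p -> free_comp a q -> free_comp a (p + q).
  move=> Fp Fq y v; rewrite !mcoeffD.
  have [->|/Fp//] := eqVneq (mcoeff v (mcoeff y p)) 0.
  by rewrite add0r => /Fq.
split=> //.
- move=> a c p Fp y v; rewrite mcoeffZ mcoeffCM => h; apply: Fp.
  by apply: contraNneq h => ->; rewrite mulr0.
- move=> i al al0 a p Fp y v; rewrite mcoeffZ => h.
  have /msuppM_le[v1 [v2 []]] : v \in msupp (xpow (nnvec_axis i al0) * mcoeff y p).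
    by rewrite -mcoeff_neq0.
  rewrite msuppU1 inE => /eqP -> v2p ->.
  have /= := Fp y v2; rewrite mcoeff_neq0 => /(_ v2p) v2E.
  by rewrite /= v2E addrC addrAC.
- move=> p.
  have [//|//||s [f [us Ff sf]]] := @collect _ free_comp
    [seq (gs_gr y + nnval v, mkmalgU y (mkmalgU v (mcoeff v (mcoeff y p))))
      | y <- msupp p, v <- msupp (mcoeff y p)].
    move=> _ /allpairsPdep[y [v [_ _ ->]]] y' v' /=.
    rewrite mcoeffU; have [<-|_] := eqVneq y y'; last by rewrite mulr0n mcoeff0 eqxx.
    rewrite mulr1n mcoeffU; have [<- _|_] := eqVneq v v'; last by rewrite mulr0n eqxx.
    by rewrite addrC addKr.
  exists s, f; split=> //; rewrite -sf big_allpairs_dep /= [LHS]monalgE.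
  apply: eq_bigr => y _; rewrite -raddf_sum; congr mkmalgU; exact: monalgE.
- move=> s f us Ff f0 a sa; apply/malgP => y; apply/malgP => v; rewrite !mcoeff0.
  have [av|av] := eqVneq (nnval v) (a - gs_gr y); last first.
    apply/eqP; apply: contraNT av => /Ff ->; exact: eqxx.
  have := congr1 (fun p => mcoeff v (mcoeff y p)) f0.
  rewrite !mcoeff0 !raddf_sum (bigD1_seq a) //= big1 ?addr0 // => b ba.
  apply/eqP; apply: contraNT ba => /Ff; rewrite av => /addIr ->.
  exact: eqxx.
Qed.

Definition free : pmod := PMod free_subproof.

Definition gen (y : G) : free := mkmalgU y 1.

End FreeModule.

Record presentation := Presentation {
  gens : gset;
  rels : set (free gens);
  rels_homogeneous : forall r, rels r -> exists a, pm_comp (free gens) a r }.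

Arguments rels : clear implicits.

Definition pres_mod (P : presentation) : pmod :=
  quot_pmod (@rels_homogeneous P).

Definition presents (P : presentation) (M : pmod) : Prop :=
  isomorphic M (pres_mod P).

Definition finitely_presented (M : pmod) : Prop :=
  exists P, [/\ presents P M, finite_set [set: gens P] & finite_set (rels P)].

(* Injectivity expresses that the generators are minimal as a family: distinct
   generators are not identified in the quotient. *)
Definition minimal (P : presentation) : Prop :=
  [/\ injective (fun y : gens P => lpi (rels P) (gen y)),
      minimal_generators [set lpi (rels P) (gen y) | y in [set: gens P]] [set: pres_mod P] &
      minimal_generators (rels P) (span (rels P))].

(* A relation of a minimal presentation is nonzero, so its grade is unique. *)
Definition grades (P : presentation) : set 'rV[R]_n :=
  [set gs_gr y | y in [set: gens P]] `|`
  [set a | exists2 r, rels P r & pm_comp (free (gens P)) a r].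

(* The grades of a minimal presentation of M do not depend on its choice; [get]
   picks a value, and U_M is only meaningful when M is finitely presented. *)
Definition Uset (M : pmod) : set 'rV[R]_n :=
  get [set U | exists P, [/\ presents P M, minimal P & U = grades P]].

Definition Ucoord (M : pmod) (i : 'I_n) : set R := [set u 0 i | u in Uset M].

Definition Upair (M N : pmod) : set (\bar R) :=
  (\bigcup_(i in [set: 'I_n])
     ([set `|x - y|%:E | x in Ucoord M i & y in Ucoord N i] `|`
      [set (2^-1 * `|x - y|)%:E | x in Ucoord M i & y in Ucoord M i] `|`
      [set (2^-1 * `|x - y|)%:E | x in Ucoord N i & y in Ucoord N i]))
  `|` [set 0%E; +oo%E].

End PersistenceModules.

(* Main.v *)
(* Multiplication by x^v, from degree a to degree a + v, is bijective as soon as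
   no coordinate of a grade of a generator or relation lies in ]a_i, a_i + v_i].
   If dI M N = r were not in the finite set Upair M N, there would be e' < r <= e
   with M, N e-interleaved and no element of Upair M N in ]e', e]. The images of
   the generators under the two interleaving morphisms then lift uniquely along
   the transition maps, and the lifts form an e'-interleaving, contradicting
   e' < r. Finiteness of Upair M N rests on Schanuel's lemma: any minimal
   presentation of a finitely presented module is finite. *)
From Pilot Require Import Defs.
From mathcomp Require Import all_boot all_order all_algebra.
From mathcomp Require Import boolp classical_sets reals constructive_ereal ereal.
From HB Require Import structures.
From mathcomp Require Import cardinality.
From mathcomp Require Import -(notations) finmap.
From mathcomp.multinomials Require Import -(notations) monalg.
Import Pilot.Defs.

Set Implicit Arguments.
Unset Strict Implicit.
Unset Printing Implicit Defensive.

Import Order.TTheory GRing.Theory Num.Theory.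

Local Open Scope classical_set_scope.
Local Open Scope ring_scope.

Arguments pm_comp {k R n} p a _ : rename.
Arguments rels {k R n} p _ : rename.

(** * Homogeneous elements and graded morphisms *)

Section Gradings.
Variables (k : fieldType) (R : realType) (n : nat).
Implicit Types (M N A F : pmod k R n) (a b : 'rV[R]_n) (v : nnvec R n).

Lemma nnvec_sub a b : (forall i, a 0 i <= b 0 i) ->
  exists v : nnvec R n, b = a + nnval v.
Proof.
move=> ab; have H : [forall i, 0 <= (b - a) 0 i].
  by apply/forallP => i; rewrite !mxE subr_ge0.
by exists (NNVec H); rewrite /= addrC subrK.
Qed.

Lemma nnvec_le a v i : a 0 i <= (a + nnval v) 0 i.
Proof. by rewrite mxE lerDl nnvec_ge0. Qed.

Lemma comp0 M a : pm_comp M a 0.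
Proof. exact: grading0 (pm_grading M) a. Qed.

Lemma compD M a x y : pm_comp M a x -> pm_comp M a y -> pm_comp M a (x + y).
Proof. exact: gradingD (pm_grading M) a x y. Qed.

Lemma compN M a x : pm_comp M a x -> pm_comp M a (- x).
Proof.
move=> Mx; have := gradingZ (pm_grading M) (-1) Mx.
have -> : Bscalar R n (-1 : k) = - 1 by rewrite /Bscalar monalgUN.
by rewrite scaleN1r.
Qed.

Lemma compB M a x y : pm_comp M a x -> pm_comp M a y -> pm_comp M a (x - y).
Proof. by move=> Mx My; apply: compD => //; apply: compN. Qed.

Lemma comp_sum M a I (s : seq I) (P : pred I) (f : I -> M) :
  (forall i, P i -> pm_comp M a (f i)) -> pm_comp M a (\sum_(i <- s | P i) f i).
Proof. by move=> Mf; apply: big_ind => //; [apply: comp0|apply: compD]. Qed.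

(** Placing [x] in degree [b] and subtracting it from the family [f] gives a homogeneous family of
    sum zero, whose terms vanish because the decomposition is direct. *)
Lemma comp_component M b x (s : seq 'rV[R]_n) (f : 'rV[R]_n -> M) :
  uniq s -> (forall a, pm_comp M a (f a)) -> pm_comp M b x ->
  x = \sum_(a <- s) f a -> x = if b \in s then f b else 0.
Proof.
move=> us Mf Mx xE.
pose g a := (if a \in s then f a else 0) - (if a == b then x else 0).
have Mg a : pm_comp M a (g a).
  apply: compB; first by case: ifP => _; [apply: Mf|apply: comp0].
  by case: eqP => [->|_] //; apply: comp0.
have [u uu uE] : exists2 u, uniq u & forall a, (a \in u) = (a == b) || (a \in s).
  by exists (undup (b :: s)) => [|a]; rewrite ?undup_uniq // mem_undup inE.
have sum_g : \sum_(a <- u) g a = 0.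
  rewrite sumrB -[X in X - _]big_mkcond -[X in _ - X]big_mkcond /=.
  rewrite -[X in X - _]big_filter -[X in _ - X]big_filter.
  rewrite [X in _ - X](@perm_big _ _ _ _ _ [:: b]) ?big_seq1; last first.
    apply: uniq_perm => // [|a]; first by rewrite filter_uniq.
    by rewrite mem_filter uE !inE; case: (a == b).
  rewrite [X in X - _](_ : _ = x) ?subrr // [RHS]xE; apply: perm_big.
  apply: uniq_perm => // [|a]; first by rewrite filter_uniq.
  by rewrite mem_filter uE; case: (a \in s); rewrite ?orbT ?andbF.
have bu : b \in u by rewrite uE eqxx.
have /eqP := grading_direct (pm_grading M) uu Mg sum_g bu.
by rewrite /g eqxx subr_eq0 => /eqP.
Qed.

Lemma comp_eq M a b x : pm_comp M a x -> pm_comp M b x -> x != 0 -> a = b.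
Proof.
move=> Max Mbx x0; have [//|ab] := eqVneq a b; case/eqP: x0.
pose f c : M := if c == a then x else 0.
have := @comp_component M b x [:: a] f; rewrite inE [b == a]eq_sym (negbTE ab).
apply=> // [c|]; last by rewrite big_seq1 /f eqxx.
by rewrite /f; case: eqP => [->//|_]; apply: comp0.
Qed.

(** The component of degree [a] of any preimage is again a preimage, by uniqueness of components in
    [M]. *)
Lemma hom_surj_comp A M (p : hom A M) : (forall m, exists x, p x = m) ->
  forall a m, pm_comp M a m -> exists2 x, pm_comp A a x & p x = m.
Proof.
move=> p_surj a m Mm; have [x px] := p_surj m.
have [s [f [us Af xE]]] := grading_span (pm_grading A) x.
exists (if a \in s then f a else 0); first by case: ifP => _ //; apply: comp0.
have mE : m = \sum_(b <- s) (p \o f) b by rewrite -px xE linear_sum.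
rewrite (comp_component us _ Mm mE) => [|b]; last exact/homP.
by case: ifP => // _; rewrite linear0.
Qed.

Lemma hom_factor A M N (p : hom A M) (F : hom A N) :
    (forall m, exists x, p x = m) -> (forall x, p x = 0 -> F x = 0) ->
  exists F' : hom M N, forall x, F' (p x) = F x.
Proof.
move=> p_surj pF; have /boolp.choice[q qK] := p_surj.
have FE x y : p x = p y -> F x = F y.
  by move/eqP; rewrite -subr_eq0 -linearB => /eqP/pF/eqP; rewrite linearB subr_eq0 => /eqP.
have L : linear (F \o q).
  move=> c x y /=; rewrite -linearP; apply: FE.
  by rewrite linearP !qK.
pose LL := GRing.isLinear.Build _ _ _ _ (F \o q) L.
pose F0 : {linear M -> N} := HB.pack (F \o q) LL.
have F0h a m : pm_comp M a m -> pm_comp N a (F0 m).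
  move=> /(hom_surj_comp p_surj)[x Ax <-] /=.
  by rewrite (FE _ x) ?qK //; apply: homP.
exists (Hom F0h) => x /=; apply: FE; exact: qK.
Qed.

(** * Free graded modules and their universal property *)

Section Free.
Variable G : gset R n.

Lemma gen_comp (y : G) : pm_comp (free k G) (gs_gr y) (gen k y).
Proof.
move=> z v; rewrite /gen mcoeffU; have [<-|] := eqVneq y z.
  rewrite mulr1n subrr mcoeff1; case: (boolP (v == _)) => [/eqP -> //|_].
  by rewrite eqxx.
by rewrite mulr0n mcoeff0 eqxx.
Qed.

Lemma free_gen (p : free k G) :
  p = \sum_(y <- msupp p) mcoeff y p *: (gen k y : free k G).
Proof.
rewrite {1}[p]monalgE; apply: eq_bigr => y _.
apply/malgP => z; rewrite mcoeffZ !mcoeffU.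
by rewrite mulr_natr.
Qed.

Lemma free_hom_ext (N : lmodType (Bn k R n)) (F1 F2 : {linear free k G -> N}) :
  (forall y, F1 (gen k y) = F2 (gen k y)) -> F1 =1 F2.
Proof.
move=> F12 p; rewrite [p]free_gen !linear_sum; apply: eq_bigr => y _.
by rewrite !linearZ F12.
Qed.

Lemma free_lift N (h : G -> N) : (forall y, pm_comp N (gs_gr y) (h y)) ->
  exists F : hom (free k G) N, forall y, F (gen k y) = h y.
Proof.
move=> Nh; pose F (p : free k G) : N := \sum_(y <- msupp p) mcoeff y p *: h y.
(* Enlarging the index set beyond the support only adds zero terms, so the sums for [p], [q] and
   [c *: p + q] can be compared over one common set. *)
have Fw (p : free k G) (D : finSet G) : fsubset (msupp p) D ->
    F p = \sum_(y <- D) mcoeff y p *: h y.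
  move=> pD; apply: big_fset_incl => // y _ /mcoeff_outdom ->.
  by rewrite scale0r.
have L : linear F.
  move=> c p q; pose D := (fsetU (msupp (c *: p + q)) (fsetU (msupp p) (msupp q))).
  rewrite (Fw _ D) ?fsubsetUl // (Fw p D) ?(Fw q D).
  - rewrite scaler_sumr -big_split; apply: eq_bigr => y _ /=.
    by rewrite mcoeffD mcoeffZ scalerDl scalerA.
  - by rewrite /D fsetUCA fsetUA fsubsetUr.
  - by rewrite /D fsetUCA fsubsetUl.
pose LL := GRing.isLinear.Build _ _ _ _ F L.
pose F0 : {linear free k G -> N} := HB.pack F LL.
have F0h a p : pm_comp (free k G) a p -> pm_comp N a (F0 p).
  move=> Gp; apply: comp_sum => y _; rewrite [mcoeff y p]Bn_mono scaler_suml.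
  rewrite big_seq; apply: comp_sum => v; rewrite -mcoeff_neq0 => /Gp vE.
  rewrite -scalerA; apply: (gradingZ (pm_grading N)).
  by move: (pm_comp_xpow v (Nh y)); rewrite vE addrC subrK.
exists (Hom F0h) => y /=; rewrite (Fw _ (fset1 y)) ?msuppU_le //.
by rewrite big_seq_fset1 mcoeffUU scale1r.
Qed.

(** Translation of exponents by [v] is injective, so the coefficient of the product at [v + w] is
    the coefficient of [p] at [w]. *)
Lemma free_xpow_inj v (p : free k G) : xpow k v *: p = 0 -> p = 0.
Proof.
move=> vp0; apply/malgP => y; apply/malgP => w.
have := congr1 (fun q => mcoeff (nnvecD v w) (mcoeff y q)) vp0.
rewrite mcoeffZ !mcoeff0 => <-.
rewrite [in RHS](monalgE (mcoeff y p)) mulr_sumr raddf_sum /=.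
rewrite [in LHS](monalgE (mcoeff y p)) raddf_sum /=; apply: eq_bigr => u _.
rewrite /xpow malgM_def fgmulUU mul1r !mcoeffU; congr (_ *+ nat_of_bool _).
apply/idP/idP => [/eqP->//|/eqP/(congr1 (@nnval R n)) /= /addrI H].
by apply/eqP/val_inj.
Qed.

End Free.

End Gradings.

(** * Spans of homogeneous elements and presentations *)

Section Presentations.
Variables (k : fieldType) (R : realType) (n : nat).
Implicit Types (M N A F : pmod k R n) (a b : 'rV[R]_n) (v : nnvec R n).

Lemma scalerCA_mul (A : comNzRingType) (V : lmodType A) (c x y : A) (m : V) :
  (c * (x * y)) *: m = x *: ((c * y) *: m).
Proof. by rewrite scalerA mulrCA. Qed.

Lemma span_sub (M : lmodType (Bn k R n)) (S T : set M) :
  S `<=` span T -> span S `<=` span T.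
Proof.
move=> ST _ [s [Ss ->]]; rewrite big_seq; apply: span_sum => p /Ss/ST.
exact: spanZ.
Qed.

Lemma span_mono (M : lmodType (Bn k R n)) (S T : set M) :
  S `<=` T -> span S `<=` span T.
Proof. by move=> ST; apply: span_sub => x /ST; apply: spanS. Qed.

Lemma span_image (M N : lmodType (Bn k R n)) (f : {linear M -> N}) (S : set M) :
  span (f @` S) = f @` span S.
Proof.
apply/seteqP; split.
  move=> _ [s [+ ->]]; elim: s => [|q s IHs] Ss.
    by exists 0; [apply: span0|rewrite big_nil linear0].
  have [x Sx fx] : (f @` S) q.2 by apply: Ss; rewrite mem_head.
  have [|y Sy fy] := IHs; first by move=> p ps; apply: Ss; rewrite inE ps orbT.
  exists (q.1 *: x + y); first by apply: spanD => //; apply/spanZ/spanS.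
  by rewrite big_cons linearD linearZ fx fy.
move=> _ [_ [s [Ss ->]] <-]; rewrite linear_sum big_seq; apply: span_sum => p ps.
by rewrite linearZ; apply/spanZ/spanS; exists p.2 => //; apply: Ss.
Qed.

(* Only elements of [S] of degree at most [a + v] contribute to the part of
   [span S] of degree [a + v]. *)
Lemma span_transition F (S : set F) a v :
    (forall r, S r -> exists d, pm_comp F d r /\
      ((forall i, d 0 i <= (a + nnval v) 0 i) -> forall i, d 0 i <= a 0 i)) ->
  forall w, span S w -> pm_comp F (a + nnval v) w ->
  exists w', [/\ span S w', pm_comp F a w' & w = xpow k v *: w'].
Proof.
move=> Sd w [t [St wE]] Fw.
pose d r := xget 0 [set d | pm_comp F d r /\
  ((forall i, d 0 i <= (a + nnval v) 0 i) -> forall i, d 0 i <= a 0 i)].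
have dP r : S r -> pm_comp F (d r) r /\
    ((forall i, d r 0 i <= (a + nnval v) 0 i) -> forall i, d r 0 i <= a 0 i).
  by move=> /Sd Sr; apply: (xgetPex _ Sr).
(* [Q] adds to homogeneity the desired divisibility by [x^v], demanded in degree [a + v] only. It is
   closed under sums, hence survives the regrouping by degree in [collect]. *)
pose Q b m := pm_comp F b m /\ (b = a + nnval v ->
  exists w', [/\ span S w', pm_comp F a w' & m = xpow k v *: w']).
have Q0 b : Q b 0.
  split=> [|_]; first exact: comp0.
  by exists 0; rewrite scaler0; split=> //; [apply: span0|apply: comp0].
have QD b m m' : Q b m -> Q b m' -> Q b (m + m').
  move=> [Fm mE] [Fm' mE']; split=> [|bE]; first exact: compD.
  have [x [Sx Fx ->]] := mE bE; have [y [Sy Fy ->]] := mE' bE.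
  by exists (x + y); rewrite scalerDr; split=> //; [apply: spanD|apply: compD].
have [|s [g [us Qg sg]]] := @collect _ _ _ F Q
  [seq (d p.2 + nnval u, (Bscalar R n (mcoeff u p.1) * xpow k u) *: p.2)
     | p <- t, u <- msupp p.1] Q0 QD.
  move=> _ /allpairsPdep[p [u [/St Sp _ ->]]] /=.
  have [Fp dp] := dP _ Sp; split=> [|bE].
    by rewrite -scalerA; apply: (gradingZ (pm_grading F)); apply: pm_comp_xpow.
  (* A term of degree [a + v] comes from an element of degree at most [a + v], hence at most [a];
     its exponent [u] therefore splits as [v + u']. *)
  have /nnvec_sub[u' aE] : forall i, d p.2 0 i <= a 0 i.
    by apply: dp => i; rewrite -bE; apply: nnvec_le.
  have uE : u = nnvecD v u'.
    apply/val_inj/(@addrI _ (d p.2)); rewrite /= bE aE -addrA.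
    by rewrite [nnval u' + _]addrC.
  exists ((Bscalar R n (mcoeff u p.1) * xpow k u') *: p.2); split.
  - exact/spanZ/spanS.
  - rewrite -scalerA aE; apply: (gradingZ (pm_grading F)); exact: pm_comp_xpow.
  - have -> : xpow k u = xpow k v * xpow k u' by rewrite uE xpowD.
    exact: scalerCA_mul.
have wE' : w = \sum_(b <- s) g b.
  rewrite -sg big_allpairs_dep wE; apply: eq_bigr => p _ /=.
  by rewrite {1}[p.1]Bn_mono scaler_suml.
have gF b : pm_comp F b (g b) by have [] := Qg b.
rewrite (comp_component us gF Fw wE'); case: ifP => _.
  by have [_ /(_ erefl)] := Qg (a + nnval v).
by have [_ /(_ erefl)] := Q0 (a + nnval v).
Qed.

(** This is a presentation read as an exact sequence, which lets arguments run in the free module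
    and in [M] instead of the quotient. *)
Definition resolves (P : presentation k R n) M (p : hom (free k (gens P)) M) :=
  (forall m, exists x, p x = m) /\ (forall x, p x = 0 <-> span (rels P) x).

Lemma presents_resolves (P : presentation k R n) M :
  presents P M -> exists p : hom (free k (gens P)) M, resolves p.
Proof.
move=> [f [g [fK gK]]]; pose p := [the {linear _ -> _} of g \o lpi (rels P)].
have ph a m : pm_comp (free k (gens P)) a m -> pm_comp M a (p m).
  by move=> Gm; apply: (homP g); exists m.
exists (Hom ph); split=> [m|x] /=.
  by exists (lrepr (f m)); rewrite lreprK fK.
rewrite -[x in span _ x]subr0 -lpi_eq linear0; split=> [|->].
  by move=> /(congr1 f); rewrite gK linear0.
exact: linear0.
Qed.

(** [M] and the quotient are images of the same free module with the same kernel, so each projection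
    factors through the other. *)
Lemma resolves_presents (P : presentation k R n) M
  (p : hom (free k (gens P)) M) : resolves p ->
  exists (f : hom M (pres_mod P)) (g : hom (pres_mod P) M),
    [/\ cancel f g, cancel g f & forall x, g (lpi (rels P) x) = p x].
Proof.
move=> [p_surj pK].
have qh a m : pm_comp (free k (gens P)) a m ->
    pm_comp (pres_mod P) a (lpi (rels P) m) by move=> Gm; exists m.
have q_surj (m : pres_mod P) : exists x, lpi (rels P) x = m.
  by exists (lrepr m); rewrite lreprK.
have qK x : lpi (rels P) x = 0 <-> span (rels P) x.
  by rewrite -[x in span _ x]subr0 -lpi_eq linear0.
pose q : hom (free k (gens P)) (pres_mod P) :=
  @Hom _ _ _ (free k (gens P)) (pres_mod P) [the {linear _ -> _} of lpi (rels P)] qh.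
have [f fE] := @hom_factor _ _ _ _ _ _ p q p_surj (fun x => (qK x).2 \o (pK x).1).
have [g gE] := @hom_factor _ _ _ _ _ _ q p q_surj (fun x => (pK x).2 \o (qK x).1).
exists f, g; split=> // [m|m].
  by have [x <-] := p_surj m; rewrite fE gE.
by have [x <-] := q_surj m; rewrite gE fE.
Qed.

(** * Bijectivity of transition maps across a range free of grades *)

Section Transition.
Variables (P : presentation k R n) (M : pmod k R n) (p : hom (free k (gens P)) M).
Variables (a : 'rV[R]_n) (v : nnvec R n).
Hypothesis p_res : resolves p.
Hypothesis no_grade : forall u, grades P u ->
  forall i, u 0 i <= (a + nnval v) 0 i -> u 0 i <= a 0 i.

(** Only grades of generators matter here: a lift to the free module is a combination of generators
    of degree at most [a], hence divisible by [x^v]. *)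
Lemma transition_surj m : pm_comp M (a + nnval v) m ->
  exists2 m', pm_comp M a m' & xpow k v *: m' = m.
Proof.
move=> /(hom_surj_comp p_res.1)[x Fx <-].
have [||x' [_ Fx' ->]] := @span_transition (free k (gens P))
  (@gen k R n (gens P) @` [set: gens P]) a v _ x _ Fx.
- move=> _ [y _ <-]; exists (gs_gr y); split; first exact: gen_comp.
  by move=> le_y i; apply: no_grade => //; left; exists y.
- rewrite [x]free_gen; apply: span_sum => y _; apply/spanZ/spanS.
  by exists y.
by exists (p x'); [apply: homP|rewrite linearZ].
Qed.

(** Here the grades of relations matter: if [x^v x] is a combination of relations, it is [x^v] times
    another such combination, and [x^v] cancels in the free module. *)
Lemma transition_inj m : pm_comp M a m -> xpow k v *: m = 0 -> m = 0.
Proof.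
move=> /(hom_surj_comp p_res.1)[x Fx <-].
rewrite -linearZ => /p_res.2 Sx.
have [||x' [Sx' _ /eqP]] := @span_transition _ (rels P) a v _ _ Sx.
- move=> r Rr; have [d Fd] := rels_homogeneous Rr.
  by exists d; split=> // le_d i; apply: no_grade => //; right; exists r.
- exact: pm_comp_xpow.
rewrite -subr_eq0 -scalerBr => /eqP/free_xpow_inj/eqP; rewrite subr_eq0 => /eqP ->.
exact/p_res.2.
Qed.

End Transition.

End Presentations.

(** * Shrinking an interleaving across a gap *)

Section Interleavings.
Variables (k : fieldType) (R : realType) (n : nat).
Implicit Types (M N A F : pmod k R n) (a b : 'rV[R]_n) (v : nnvec R n).

Lemma resolves_ind (P : presentation k R n) M (p : hom (free k (gens P)) M)
    (K : M -> Prop) :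
    resolves p -> K 0 -> (forall m m', K m -> K m' -> K (m + m')) ->
    (forall c m, K m -> K (c *: m)) -> (forall y, K (p (gen k y))) ->
  forall m, K m.
Proof.
move=> [p_surj _] K0 KD KZ Kgen m; have [x <-] := p_surj m.
rewrite [x]free_gen linear_sum; apply: big_ind => // y _.
by rewrite linearZ; apply: KZ.
Qed.

(** The images of the generators are divided by [x^d] using surjectivity of the transition maps of
    [N]; injectivity makes the lifts respect the relations. *)
Lemma shrink_hom (P Q : presentation k R n) M N
    (p : hom (free k (gens P)) M) (q : hom (free k (gens Q)) N)
    (e d : R) (d0 : 0 <= d) (f : hom M (eshift N (e + d))) :
    resolves p -> resolves q ->
    (forall a u, grades P a -> grades Q u ->
      forall i, u 0 i <= a 0 i + (e + d) -> u 0 i <= a 0 i + e) ->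
  exists f' : hom M (eshift N e),
    forall m, xpow k (nnvec_diag n d0) *: (f' m : N) = f m.
Proof.
move=> p_res q_res gap; set w := nnvec_diag n d0.
have degE (a : 'rV[R]_n) : a + const_mx (e + d) = a + const_mx e + nnval w.
  by rewrite -addrA; congr (_ + _); apply/rowP => i; rewrite !mxE.
have no_grade a : grades P a -> forall u, grades Q u -> forall i,
    u 0 i <= (a + const_mx e + nnval w) 0 i -> u 0 i <= (a + const_mx e) 0 i.
  by move=> Pa u Qu i; rewrite -degE !mxE; apply: gap.
have /boolp.choice[h hP] (y : gens P) : exists m : N,
    pm_comp N (gs_gr y + const_mx e) m /\ xpow k w *: m = f (p (gen k y)).
  have [||m Nm mE] := @transition_surj _ _ _ Q N q (gs_gr y + const_mx e) w q_res _
    (f (p (gen k y))).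
  - by apply: no_grade; left; exists y.
  - by rewrite -degE; apply: (homP f); apply: homP; apply: gen_comp.
  by exists m.
have [F FE] := @free_lift _ _ _ (gens P) (eshift N e) h (fun y => (hP y).1).
have wF x : xpow k w *: (F x : N) = f (p x).
  rewrite [x]free_gen !linear_sum;
  apply: eq_bigr => y _; rewrite !linearZ FE.
  by have [_ <-] := hP y.
have [|f' f'E] := @hom_factor _ _ _ _ _ _ p F p_res.1.
  (* For a relation [r], [x^d F(r) = f(p(r)) = 0], and multiplication by [x^d] is injective in the
     degree of [F(r)]. *)
  move=> x /p_res.2 [s [Rs ->]]; rewrite linear_sum big_seq big1 // => r /Rs Rr.
  rewrite linearZ /=; suff -> : F r.2 = 0 by rewrite scaler0.
  have [a Fa] := rels_homogeneous Rr.
  apply: (@transition_inj _ _ _ Q N q (a + const_mx e) w q_res).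
  - by apply: no_grade; right; exists r.2.
  - exact: (homP F).
  - rewrite wF; suff -> : p r.2 = 0 by rewrite linear0.
    exact/p_res.2/spanS.
by exists f' => m; have [x <-] := p_res.1 m; rewrite f'E wF.
Qed.

Lemma shrink_comp (P : presentation k R n) M N (p : hom (free k (gens P)) M)
    (e d : R) (e0 : 0 <= e) (d0 : 0 <= d) (ed0 : 0 <= e + d)
    (f : hom M (eshift N (e + d))) (g : hom N (eshift M (e + d)))
    (f' : hom M (eshift N e)) (g' : hom N (eshift M e)) :
    resolves p ->
    (forall a u, grades P a -> grades P u ->
      forall i, u 0 i <= a 0 i + (e + d) *+ 2 -> u 0 i <= a 0 i + e *+ 2) ->
    (forall m, xpow k (nnvec_diag n d0) *: (f' m : N) = f m) ->
    (forall m, xpow k (nnvec_diag n d0) *: (g' m : M) = g m) ->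
    (forall m, eshift_hom g (e + d) (f m) = Smap M (mulrn_wge0 2 ed0) m :> M) ->
  forall m, eshift_hom g' e (f' m) = Smap M (mulrn_wge0 2 e0) m :> M.
Proof.
move=> p_res gap f'E g'E gf.
(* Both sides are linear, so they are compared on generators, whose degrees are grades and thus
   subject to [gap]. There the difference is killed by [x^(2d)], which acts injectively. *)
apply: (resolves_ind p_res) => [|m m' mE mE'|c m mE|y].
- by rewrite !linear0.
- by rewrite !linearD mE mE'.
- by rewrite !linearZ /=; congr (_ *: _).
have Gy := homP p (@gen_comp _ _ _ _ y); set m := p (gen k y) in Gy *.
apply/subr0_eq; pose w := nnvecD (nnvec_diag n d0) (nnvec_diag n d0).
apply: (@transition_inj _ _ _ P M p (gs_gr y + const_mx (e *+ 2)) w p_res).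
- move=> u Pu i; rewrite !mxE => ui; apply: gap => //; first by left; exists y.
  by move: ui; rewrite mulrnDl [d *+ 2]mulr2n !addrA.
- apply: compB.
    have := homP g' (homP f' Gy); rewrite /= -addrA.
    suff -> : const_mx e + const_mx e = const_mx (e *+ 2) :> 'rV[R]_n by [].
    by apply/rowP => i; rewrite !mxE mulr2n.
  exact: (homP (Smap M (mulrn_wge0 2 e0))).
rewrite scalerBr; apply/eqP; rewrite subr_eq0; apply/eqP.
(* One factor [x^d] passes through [g'] and turns [f'] into [f]; the other turns [g'] into [g]. *)
transitivity (g (f m : N) : M).
  by rewrite xpowD -scalerA -f'E -g'E [X in _ = _ *: X]linearZ.
have vE : nnvec_diag n (mulrn_wge0 2 ed0) =
    nnvecD w (nnvec_diag n (mulrn_wge0 2 e0)).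
  apply/val_inj/rowP => i; rewrite /= !mxE mulrnDl [d *+ 2]mulr2n.
  by rewrite addrC.
transitivity (xpow k (nnvec_diag n (mulrn_wge0 2 ed0)) *: m); first exact: gf.
rewrite vE xpowD; exact/esym/scalerA.
Qed.

Lemma interleaved_shrink (P Q : presentation k R n) M N
    (p : hom (free k (gens P)) M) (q : hom (free k (gens Q)) N)
    (e d : R) (e0 : 0 <= e) (d0 : 0 <= d) (ed0 : 0 <= e + d) :
    resolves p -> resolves q ->
    (forall a u, grades P a -> grades Q u ->
      forall i, u 0 i <= a 0 i + (e + d) -> u 0 i <= a 0 i + e) ->
    (forall a u, grades Q a -> grades P u ->
      forall i, u 0 i <= a 0 i + (e + d) -> u 0 i <= a 0 i + e) ->
    (forall a u, grades P a -> grades P u ->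
      forall i, u 0 i <= a 0 i + (e + d) *+ 2 -> u 0 i <= a 0 i + e *+ 2) ->
    (forall a u, grades Q a -> grades Q u ->
      forall i, u 0 i <= a 0 i + (e + d) *+ 2 -> u 0 i <= a 0 i + e *+ 2) ->
  interleaved M N ed0 -> interleaved M N e0.
Proof.
move=> p_res q_res PQ QP PP QQ [f [g [gf fg]]].
have [f' f'E] := shrink_hom d0 f p_res q_res PQ.
have [g' g'E] := shrink_hom d0 g q_res p_res QP.
exists f', g'; split.
  move=> m; exact: (shrink_comp e0 p_res PP f'E g'E gf).
move=> m; exact: (shrink_comp e0 q_res QQ g'E f'E fg).
Qed.

End Interleavings.

(** * Existence and finiteness of minimal presentations *)

Section MinimalPresentations.
Variables (k : fieldType) (R : realType) (n : nat).
Implicit Types (M N A F : pmod k R n) (a b : 'rV[R]_n) (v : nnvec R n).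

(** Each element of [T] involves finitely many elements of [S]. Together these already span, so by
    minimality they exhaust [S]. *)
Lemma minimal_generators_finite (M : lmodType (Bn k R n)) (S T : set M) :
  minimal_generators S (span T) -> finite_set T -> finite_set S.
Proof.
move=> [ST Smin] /finite_seqP[t tE].
have [D [Dfin DS TD]] : exists D, [/\ finite_set D, D `<=` S & T `<=` span D].
  have : T `<=` span S by rewrite ST => x; apply: spanS.
  rewrite {}tE; elim: t => [|x t IHt] St.
    by exists set0; split=> // x; rewrite in_nil.
  have [|D [Dfin DS tD]] := IHt; first by move=> y yt; apply: St; rewrite /= inE yt orbT.
  have [s [Ss xE]] : span S x by apply: St; rewrite /= mem_head.
  exists (D `|` snd @` [set` s]); split.
  - by rewrite finite_setU; split=> //; apply/finite_image/finite_seq.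
  - by move=> y [/DS//|[p /Ss + <-]].
  - move=> y; rewrite /= inE => /predU1P[->|/tD]; last exact/span_mono/subsetUl.
    by exists s; split=> // p ps; right; exists p.
have [DS'|DS'] := pselect (S `<=` D); first by rewrite (_ : S = D) //; apply/seteqP.
have := Smin D; case; first by split.
apply/seteqP; split; last exact: span_sub.
by rewrite -ST; apply: span_mono.
Qed.

(** A shortest list in [T] with the same span is minimal, since a proper spanning subset would give
    a shorter list. *)
Lemma finite_minimal_generators (M : lmodType (Bn k R n)) (T : set M) :
  finite_set T -> exists2 S, S `<=` T & minimal_generators S (span T).
Proof.
move=> /finite_seqP[t tE].
pose Q m := `[< exists s : seq M,
  [/\ size s = m, [set` s] `<=` T & span [set` s] = span T] >].
have exQ : exists m, Q m.
  by exists (size t); apply/asboolP; exists t; rewrite tE; split.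
case: (ex_minnP exQ) => m /asboolP[s [sz sT spE]] m_min.
exists [set` s] => //; split=> // S' [S's sS'] S'E; apply: sS' => x /= xs.
apply: contrapT => S'x.
pose s' := [seq y <- s | `[< S' y >]].
have /m_min : Q (size s').
  apply/asboolP; exists s'; split=> //.
    by move=> y /=; rewrite mem_filter => /andP[_ ys]; apply: sT.
  rewrite -S'E; congr span; apply/seteqP; split=> y /=.
    by rewrite mem_filter => /andP[/asboolP].
  by move=> S'y; rewrite mem_filter S's // andbT; apply/asboolP.
rewrite -sz size_filter leqNgt ltn_neqAle count_size andbT -all_count.
by move=> /negP; apply; apply/allPn; exists x => //; apply/asboolP.
Qed.

(* Schanuel: if [al] and [be] lift [p0] and [p] through each other, the kernel
   of [p] is generated by the image of that of [p0] under [al] and by the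
   elements [y - al (be y)], for [y] in [G]. *)
Lemma kernel_finite (G0 G : gset R n) M
    (p0 : hom (free k G0) M) (p : hom (free k G) M) (T0 : set (free k G0)) :
    (forall m, exists x, p0 x = m) -> (forall m, exists x, p x = m) ->
    finite_set [set: G] -> finite_set T0 ->
    (forall r, T0 r -> exists a, pm_comp (free k G0) a r) ->
    (forall x, p0 x = 0 <-> span T0 x) ->
  exists T : set (free k G),
    [/\ finite_set T, forall r, T r -> exists a, pm_comp (free k G) a r &
        forall x, p x = 0 <-> span T x].
Proof.
move=> p0_surj p_surj Gfin T0fin T0hom p0K.
have lift_gen (G1 G2 : gset R n) (p1 : hom (free k G1) M) (p2 : hom (free k G2) M) :
    (forall m, exists x, p2 x = m) ->
    exists F : hom (free k G1) (free k G2), forall x, p2 (F x) = p1 x.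
  move=> p2_surj.
  have /boolp.choice[h hP] (y : G1) : exists x : free k G2,
      pm_comp (free k G2) (gs_gr y) x /\ p2 x = p1 (gen k y).
    have [x Fx xE] := hom_surj_comp p2_surj (homP p1 (@gen_comp k _ _ _ y)).
    by exists x.
  have [F FE] := free_lift (fun y => (hP y).1).
  exists F => x; apply: (@free_hom_ext _ _ _ _ _ [the {linear _ -> _} of p2 \o F]).
  by move=> y /=; rewrite FE; have [] := hP y.
have [al alE] := lift_gen _ _ p0 p p_surj.
have [be beE] := lift_gen _ _ p p0 p0_surj.
pose S1 : set (free k G) := al @` T0.
pose S2 : set (free k G) := (fun y => gen k y - al (be (gen k y))) @` [set: G].
exists (S1 `|` S2); split.
- by rewrite finite_setU; split; apply: finite_image.
- move=> _ [[r /T0hom[a Fr] <-]|[y _ <-]]; first by exists a; apply: homP.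
  by exists (gs_gr y); apply: compB; [|do 2!apply: homP]; apply: gen_comp.
move=> x; split=> [px|].
  (* [be x] lies in the kernel of [p0], which handles [al (be x)]; the difference [x - al (be x)] is
     linear in [x], hence generated by its values on generators. *)
  rewrite -[x](subrK (al (be x))); apply: spanD; last first.
    apply: (@span_mono _ _ _ _ S1); first exact: subsetUl.
    by rewrite span_image; exists (be x) => //; apply/p0K; rewrite beE.
  apply: (@span_mono _ _ _ _ S2); first exact: subsetUr.
  pose D := [the {linear free k G -> free k G} of idfun \- (al \o be)].
  rewrite (_ : x - _ = D x) // [x]free_gen linear_sum; apply: span_sum => y _.
  by rewrite linearZ; apply/spanZ/spanS; exists y.
move=> [s [Ss ->]]; rewrite linear_sum big_seq big1 // => r /Ss Sr.
rewrite linearZ /=; suff -> : p r.2 = 0 by rewrite scaler0.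
case: Sr => [[z T0z <-]|[y _ <-]]; first by rewrite alE; apply/p0K/spanS.
by rewrite linearB alE beE subrr.
Qed.

Lemma minimal_generators_neq0 (M : lmodType (Bn k R n)) (S W : set M) x :
  minimal_generators S W -> S x -> x != 0.
Proof.
move=> [SW Smin] Sx; apply/eqP => x0; have := Smin (S `\ x); case.
  by split=> [y []//|/(_ x Sx)[_]]; apply.
apply/seteqP; split; first by rewrite -SW; apply: span_mono => y [].
rewrite -SW; apply: span_sub => y Sy; have [->|yx] := eqVneq y x.
  by rewrite x0; apply: span0.
by apply: spanS; split=> //; apply/eqP.
Qed.

Lemma gens_span (G : gset R n) M (p : hom (free k G) M) :
  (forall m, exists x, p x = m) ->
  span ((fun y => p (gen k y)) @` [set: G]) = [set: M].
Proof.
move=> p_surj; apply/seteqP; split=> // m _; have [x <-] := p_surj m.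
rewrite [x]free_gen linear_sum; apply: span_sum => y _.
by rewrite linearZ; apply/spanZ/spanS; exists y.
Qed.

Lemma finite_grades (P : presentation k R n) M :
  finitely_presented M -> presents P M -> minimal P -> finite_set (grades P).
Proof.
move=> [P0 [/presents_resolves[p0 [p0_surj p0K]] G0fin R0fin]] PM [Ginj Gmin Rmin].
have [p [p_surj pK]] := presents_resolves PM.
have [f [g [_ gK]]] := PM.
pose T := f @` ((fun y => p0 (gen k y)) @` [set: gens P0]).
have spT : span T = [set: pres_mod P].
  rewrite /T span_image gens_span //; apply/seteqP; split=> // m _.
  by exists (g m) => //; apply: gK.
have Gfin : finite_set [set: gens P].
  have : finite_set ((fun y => lpi (rels P) (gen k y)) @` [set: gens P]).
    move: Gmin; rewrite -spT => /minimal_generators_finite; apply.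
    by do 2!apply: finite_image.
  by rewrite (eq_finite_set (inj_card_eq _)) // => y z _ _; apply: Ginj.
have Rfin : finite_set (rels P).
  have [T' [T'fin _ T'K]] := kernel_finite p0_surj p_surj Gfin R0fin
    (@rels_homogeneous _ _ _ P0) p0K.
  apply: (minimal_generators_finite _ T'fin).
  suff <- : span (rels P) = span T' by [].
  by apply/seteqP; split=> x; rewrite -pK -T'K.
rewrite /grades finite_setU; split; first exact: finite_image.
(* Relations of a minimal presentation are nonzero, so each has a single degree and their grades are
   the image of a finite set under [d]. *)
pose d r := xget 0 [set a | pm_comp (free k (gens P)) a r].
apply: (sub_finite_set _ (finite_image d Rfin)) => a [r Rr Fr].
exists r => //; apply: comp_eq (minimal_generators_neq0 Rmin Rr) => //.
  by apply: (@xgetPex _ 0 [set a | pm_comp (free k (gens P)) a r]); exists a.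
Qed.

(** The generators are a minimal part of the images in [M] of given finite generators. Schanuel's
    lemma gives a finite homogeneous generating set of the new kernel, which is then trimmed as
    well. *)
Lemma minimal_presentation M :
  finitely_presented M -> exists P, presents P M /\ minimal P.
Proof.
move=> [P0 [/presents_resolves[p0 [p0_surj p0K]] G0fin R0fin]].
have [S ST] := finite_minimal_generators
  (finite_image (fun y => p0 (gen k y)) G0fin).
rewrite gens_span // => Smin.
(* The generators are elements of [M] itself, hence distinct in the quotient; each is homogeneous
   and receives a degree in which it lies. *)
pose G : gset R n :=
  @GSet R n (set_type S) (fun y => xget 0 [set a | pm_comp M a (val y)]).
have valI : injective (fun y : G => val y : M) by move=> y z; apply: val_inj.
have Gcomp (y : G) : pm_comp M (gs_gr y) (val y).
  have /set_mem/ST[z _ zy] := valP y.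
  apply: (@xgetPex _ 0 [set a | pm_comp M a (val y)]); exists (gs_gr z).
  rewrite /= -zy; apply/homP/gen_comp.
have [p pE] := free_lift Gcomp.
have SE : (fun y : G => p (gen k y)) @` [set: G] = S.
  apply/seteqP; split=> [_ [y _ <-]|m Sm]; first by rewrite pE; apply/set_mem/valP.
  by exists (SigSub (mem_set Sm)) => //; rewrite pE.
have p_surj m : exists x, p x = m.
  have : span S m by rewrite Smin.1.
  rewrite -SE -image_comp span_image => -[x _ <-]; by exists x.
have Gfin : finite_set [set: G].
  have : finite_set S by apply: sub_finite_set ST (finite_image _ G0fin).
  rewrite -SE (@eq_finite_set _ _ _ [set: G]) //; apply: inj_card_eq => y z _ _.
  by rewrite (pE y) (pE z); apply: valI.
have [T [Tfin Thom TK]] := kernel_finite p0_surj p_surj Gfin R0fin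
  (@rels_homogeneous _ _ _ P0) p0K.
have [Q QT Qmin] := finite_minimal_generators Tfin.
have Qhom r : Q r -> exists a, pm_comp (free k G) a r by move=> /QT/Thom.
pose P := @Presentation k R n G Q Qhom.
have [|f [g [fK gK gE]]] := @resolves_presents k R n P M p.
  by split=> // x; rewrite TK Qmin.1.
have gI : injective g := can_inj gK.
exists P; split; first by exists f, g.
have imE : g @` [set lpi Q (gen k y) | y in [set: G]] = S.
  by rewrite image_comp -[RHS]SE; apply: eq_imagel => y _ /=; rewrite gE.
have spE (X : set (pres_mod P)) : span (g @` X) = [set: M] <-> span X = [set: pres_mod P].
  rewrite span_image; split=> XE; apply/seteqP; split=> // x _.
    by have [z Xz /gI <-] : (g @` span X) (g x) by rewrite XE.
  by exists (f x); rewrite ?XE ?fK.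
split.
- move=> y z /(congr1 g); rewrite (gE (gen k y)) (gE (gen k z)) (pE y) (pE z).
  exact: valI.
- split; first by apply/spE; rewrite imE Smin.1.
  move=> X [XI IX] /spE gX; apply: (Smin.2 (g @` X)) => //; rewrite -imE.
  split; first exact: image_subset.
  by move=> IgX; apply: IX => x Ix; have [|z Xz /gI <-] := IgX (g x); first by exists x.
- by rewrite /= Qmin.1.
Qed.

End MinimalPresentations.

(** * Finiteness and gaps of the set of candidate distances *)

Section Gap.
Variables (k : fieldType) (R : realType) (n : nat).
Implicit Types (M N A F : pmod k R n) (a b : 'rV[R]_n) (v : nnvec R n).

(** As a minimal presentation exists, [get] returns the grades of an actual one. *)
Lemma Uset_grades M : finitely_presented M ->
  exists (P : presentation k R n) (p : hom (free k (gens P)) M),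
    [/\ resolves p, finite_set (grades P) & Uset M = grades P].
Proof.
move=> Mfp; have [P0 [P0M P0min]] := minimal_presentation Mfp.
have [P [PM Pmin UE]] : [set U | exists P, [/\ presents P M, minimal P & U = grades P]]
    (Uset M) by apply: getPex; exists (grades P0), P0.
have [p p_res] := presents_resolves PM.
by exists P, p; split=> //; apply: finite_grades Mfp PM Pmin.
Qed.

Lemma finite_Upair M N :
  finite_set (Uset M) -> finite_set (Uset N) -> finite_set (Upair M N).
Proof.
move=> Mfin Nfin; rewrite /Upair finite_setU; split; last exact: finite_set2.
apply: bigcup_finite => [|i _]; first exact: finite_finset.
by rewrite !finite_setU; split; [split|]; apply: finite_image2; apply: finite_image.
Qed.

(** [d] is the least distance from [r] to a finite element of [A], capped at 1; infinite elements
    impose nothing. *)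
Lemma finite_gap (A : set (\bar R)) (r : R) : finite_set A -> ~ A r%:E ->
  exists2 d : R, 0 < d & forall x, A x%:E -> d <= `|x - r|.
Proof.
move=> /finite_seqP[s ->]; elim: s => [|y s IHs] /=; first by exists 1.
rewrite inE => /negP; rewrite negb_or => /andP[ry /negP/IHs[d d0 dP]].
case: y ry => [y||] ry; last 2 first.
- by exists d => // x; rewrite inE /= => /dP.
- by exists d => // x; rewrite inE /= => /dP.
exists (Num.min d `|y - r|) => [|x].
  rewrite lt_min d0 normr_gt0 subr_eq0.
  by apply: contraNneq ry => ->.
rewrite inE => /predU1P[[->]|/dP]; first by rewrite ge_min lexx orbT.
by rewrite ge_min => ->.
Qed.

(** Were [y] above [x + e'], then [y - x] would be an element of [A] in []e', e]]. *)
Lemma coord_gap (A : set R) (x y e e' : R) :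
  (forall z, A z -> e' < z -> e < z) -> 0 <= e' -> A `|x - y| ->
  y <= x + e -> y <= x + e'.
Proof.
move=> gap e'0 Axy yx; rewrite leNgt; apply/negP => xy.
have xyE : `|x - y| = y - x.
  by rewrite ler0_norm ?opprB // subr_le0; apply: le_trans (ltW xy); rewrite lerDl.
move: (gap _ Axy); rewrite xyE ltrBrDl => /(_ xy); rewrite ltrBrDl.
by rewrite ltNge yx.
Qed.

Lemma interleaved_gap M N (e e' : R) (e0 : 0 <= e) (e'0 : 0 <= e') :
  finitely_presented M -> finitely_presented N -> e' <= e ->
  (forall x, Upair M N x%:E -> e' < x -> e < x) ->
  interleaved M N e0 -> interleaved M N e'0.
Proof.
move=> /Uset_grades[P [p [p_res _ UP]]] /Uset_grades[Q [q [q_res _ UQ]]] e'e gap.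
have d0 : 0 <= e - e' by rewrite subr_ge0.
have eE : e = e' + (e - e') by rewrite addrC subrK.
(* [interleaved] depends on the proof [e0], which is generalized so that [e] can be rewritten in
   both types at once. *)
move: e0; rewrite {1 2}eE => e0.
have dbl (x : R) : 2^-1 * x *+ 2 = x by rewrite -mulrnAr -[x *+ 2]mulr_natl mulKf ?pnatr_eq0.
(* Differences within one module occur halved in [Upair], so they avoid []2e', 2e]], the range
   relevant to the composites. *)
have gap2 z : Upair M N (2^-1 * z)%:E -> e' *+ 2 < z -> e *+ 2 < z.
  by move=> /gap H; rewrite -(dbl z) !ltr_pMn2r.
apply: (@interleaved_shrink _ _ _ P Q M N p q e' (e - e') e'0 d0 e0) => //;
  rewrite -?eE => a u; rewrite -?UP -?UQ => aU uU i.
- apply: (coord_gap gap) => //; left; exists i => //; left; left.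
  by exists (a 0 i); [exists a|exists (u 0 i); [exists u|]].
- apply: (coord_gap gap) => //; left; exists i => //; left; left.
  by exists (u 0 i); [exists u|exists (a 0 i); [exists a|rewrite distrC]].
- apply: (coord_gap gap2); first exact: mulrn_wge0.
  left; exists i => //; left; right.
  by exists (a 0 i); [exists a|exists (u 0 i); [exists u|]].
- apply: (coord_gap gap2); first exact: mulrn_wge0.
  left; exists i => //; right.
  by exists (a 0 i); [exists a|exists (u 0 i); [exists u|]].
Qed.

End Gap.

(** * The interleaving distance is a candidate distance *)

Theorem proposition2p11p9 (k : fieldType) (R : realType) (n : nat)
    (hn : (0 < n)%N) (M N : pmod k R n)
    (hM : finitely_presented M) (hN : finitely_presented N) :
  Upair M N (dI M N).
Proof.
have Ufin : finite_set (Upair M N).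
  have [P [_ [_ Pfin UP]]] := Uset_grades hM.
  have [Q [_ [_ Qfin UQ]]] := Uset_grades hN.
  by apply: finite_Upair; rewrite ?UP ?UQ.
have dI_le (e : R) (e0 : 0 <= e) : interleaved M N e0 -> (dI M N <= e%:E)%E.
  by move=> MNe; apply: ereal_inf_lbound; exists e => //; exists e0.
have dI_ge0 : (0 <= dI M N)%E.
  by apply: le_ereal_inf_tmp => _ [e [e0 _] <-]; rewrite lee_fin.
have dI_lt x : (dI M N < x)%E ->
    exists (e : R) (e0 : 0 <= e), interleaved M N e0 /\ (e%:E < x)%E.
  by move=> /ereal_inf_lt[_ [e [e0 MNe] <-] ex]; exists e, e0.
case: (dI M N) dI_le dI_ge0 dI_lt => [r||] // dI_le r0 dI_lt; last by right; right.
apply: contrapT => Ur; have [d d0 dP] := finite_gap Ufin Ur.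
(* Zero belongs to [Upair M N], so [r] is positive and there is room for a smaller [e']. *)
have {}r0 : 0 < r.
  by rewrite lt0r -lee_fin r0 andbT; apply: contra_not_neq Ur => ->; right; left.
have [e [e0 [MNe]]] := dI_lt (r + d)%:E ltac:(by rewrite lte_fin ltrDl).
have := dI_le _ _ MNe; rewrite lee_fin lte_fin => re erd.
(* Bounding by [r] keeps [e'] nonnegative; bounding by [d] and halving puts it strictly between
   [r - d] and [r]. *)
pose e' := r - Num.min d r / 2.
have h0 : 0 < Num.min d r / 2 by rewrite divr_gt0 // lt_min d0.
have e'0 : 0 <= e'.
  rewrite subr_ge0 ler_pdivrMr // ge_min mulr_natr mulr2n; apply/orP; right.
  by rewrite lerDl ltW.
have e'r : e' < r by rewrite ltrBlDr ltrDl.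
have e'd : r - d < e'.
  rewrite ltrD2l ltrN2 ltr_pdivrMr // gt_min mulr_natr mulr2n ltrDl d0 //.
have : interleaved M N e'0.
  apply: (interleaved_gap _ hM hN _ _ MNe); first exact: ltW (lt_le_trans e'r re).
  (* A candidate [x] in []e', e]] would lie strictly within [d] of [r]. *)
  move=> x /dP dx e'x; rewrite ltNge; apply/negP => xe; move: dx.
  rewrite leNgt ltr_norml ltrBrDl (lt_trans e'd e'x) ltrBlDl /=.
  by rewrite (le_lt_trans xe erd).
by move=> /dI_le; rewrite lee_fin leNgt e'r.
Qed.
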